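(* Let $O$ be a Cayley algebra over a field $F$ of characteristic $\neq2$ and let $A\subseteq\operatorname{im}(O)$ be a three-dimensional associative subspace, i.e. $(xy)z=x(yz)$ for all $x,y,z\in A$. Then $F1\oplus A$ is closed under the multiplication of $O$, and hence is a 4-dimensional associative subalgebra of $O$.
   Context: Cayley algebra: $D_\gamma(D_\beta(D_\alpha(F)))$, $\alpha,\beta,\gamma\in F^\times$, with $D_\gamma(A)=A\oplus A$ (elements $a+ib$), $(a+ib)(c+id)=(ac+\gamma db^* )+i(a^*d+cb)$, $(a+ib)^*=a^*-ib$, starting from $F$ with identity involution; $\operatorname{im}(O)=\{a:a^*=-a\}$. *)

(* Defs.v *)
From HB Require Import structures.
From mathcomp Require Import all_boot all_order all_algebra.
Set Implicit Arguments. Unset Strict Implicit. Unset Printing Implicit Defensive.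
Import Order.TTheory GRing.Theory Num.Theory.
Local Open Scope ring_scope.

(* One Cayley-Dickson doubling step D_g(A) = A (+) A, elements a + i b <-> (a, b):
   (a+ib)(c+id) = (ac + g d b^* ) + i(a^* d + c b),   (a+ib)^* = a^* - ib. *)
Section CD.
Variable F : fieldType.
Variable T : vectType F.
Variables (mulT : T -> T -> T) (conjT : T -> T) (oneT : T).

Definition cd_mul (g : F) (x y : T * T) : T * T :=
  (mulT x.1 y.1 + g *: mulT y.2 (conjT x.2), mulT (conjT x.1) y.2 + mulT y.1 x.2).
Definition cd_conj (x : T * T) : T * T := (conjT x.1, - x.2).
Definition cd_one : T * T := (oneT, 0).
End CD.

(* The Cayley algebra O = D_gamma(D_beta(D_alpha(F))), F with identity involution. *)
Section Cayley.
Variable F : fieldType.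
Definition O1 : vectType F := F^o.
Definition O2 : vectType F := (O1 * O1)%type.
Definition O4 : vectType F := (O2 * O2)%type.
Definition O8 : vectType F := (O4 * O4)%type.

Definition mul1 : O1 -> O1 -> O1 := fun a b : F => a * b.
Definition conj1 : O1 -> O1 := id.
Definition one1 : O1 := (1 : F).

Definition mul2 (al : F) : O2 -> O2 -> O2 := @cd_mul F O1 mul1 conj1 al.
Definition conj2 : O2 -> O2 := @cd_conj F O1 conj1.
Definition one2 : O2 := @cd_one F O1 one1.

Definition mul4 (al be : F) : O4 -> O4 -> O4 := @cd_mul F O2 (mul2 al) conj2 be.
Definition conj4 : O4 -> O4 := @cd_conj F O2 conj2.
Definition one4 : O4 := @cd_one F O2 one2.

Definition omul (al be ga : F) : O8 -> O8 -> O8 := @cd_mul F O4 (mul4 al be) conj4 ga.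
Definition oconj : O8 -> O8 := @cd_conj F O4 conj4.
Definition oone : O8 := @cd_one F O4 one4.

Definition is_im (x : O8) : Prop := oconj x = - x.
End Cayley.

(* Main.v *)
Require Import Defs.
From HB Require Import structures.
From mathcomp Require Import all_boot all_order all_algebra.
From mathcomp Require Import ring.
Set Implicit Arguments. Unset Strict Implicit. Unset Printing Implicit Defensive.
Import Order.TTheory GRing.Theory Num.Theory.
Local Open Scope ring_scope.

(* Let [<.,.>] be the polar form of the norm of O, and let x, y, z be imaginary
   with vanishing associator. For imaginary u, v orthogonal to x and y,
   alternativity gives
     <x y, u> <z, v> = <z, u> <x y, v>.
   If z lies outside the span U of 1, x, y, nondegeneracy of the form provides u
   orthogonal to U with <z, u> nonzero, so that x y - (<x y, u> / <z, u>) z is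
   orthogonal to the orthogonal of U, hence lies in U; thus x y lies in U + F z.
   This covers isotropic subspaces A, where no orthogonal basis is available. *)

Section Octonions.
Variables (F : fieldType) (al be ga : F).
Notation O := (O8 F).
Notation m := (omul al be ga).
Notation cj := (@oconj F).
Notation e := (oone F).

(** Doubling turns a norm N into N(a+ib) = N(a) - g N(b); this is the matching bilinear form, scaled
    so that [oform x x] is the norm of [x]. *)
Definition cd_form {T : Type} (b : T -> T -> F) (g : F) (x y : T * T) : F :=
  b x.1 y.1 - g * b x.2 y.2.

Definition oform : O -> O -> F :=
  cd_form (cd_form (cd_form (fun a b : F => a * b) al) be) ga.

(** * Coordinates on O *)

Definition oct (a0 a1 a2 a3 a4 a5 a6 a7 : F) : O :=
  (((a0, a1), (a2, a3)), ((a4, a5), (a6, a7))).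

Lemma octP (P : O -> Prop) :
  (forall a0 a1 a2 a3 a4 a5 a6 a7, P (oct a0 a1 a2 a3 a4 a5 a6 a7)) -> forall x, P x.
Proof. by move=> h [[[a0 a1] [a2 a3]] [[a4 a5] [a6 a7]]]; apply: h. Qed.

Lemma oconj_oct a0 a1 a2 a3 a4 a5 a6 a7 :
  cj (oct a0 a1 a2 a3 a4 a5 a6 a7) = oct a0 (- a1) (- a2) (- a3) (- a4) (- a5) (- a6) (- a7).
Proof. by []. Qed.

Lemma oform_oct a0 a1 a2 a3 a4 a5 a6 a7 b0 b1 b2 b3 b4 b5 b6 b7 :
  oform (oct a0 a1 a2 a3 a4 a5 a6 a7) (oct b0 b1 b2 b3 b4 b5 b6 b7) =
  a0 * b0 - al * (a1 * b1) - be * (a2 * b2 - al * (a3 * b3))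
  - ga * (a4 * b4 - al * (a5 * b5) - be * (a6 * b6 - al * (a7 * b7))).
Proof. by []. Qed.

Lemma oone_oct : e = oct 1 0 0 0 0 0 0 0. Proof. by []. Qed.

Lemma add_oct a0 a1 a2 a3 a4 a5 a6 a7 b0 b1 b2 b3 b4 b5 b6 b7 :
  oct a0 a1 a2 a3 a4 a5 a6 a7 + oct b0 b1 b2 b3 b4 b5 b6 b7 =
  oct (a0 + b0) (a1 + b1) (a2 + b2) (a3 + b3) (a4 + b4) (a5 + b5) (a6 + b6) (a7 + b7).
Proof. by []. Qed.

Lemma opp_oct a0 a1 a2 a3 a4 a5 a6 a7 :
  - oct a0 a1 a2 a3 a4 a5 a6 a7 =
  oct (- a0) (- a1) (- a2) (- a3) (- a4) (- a5) (- a6) (- a7).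
Proof. by []. Qed.

Lemma scale_oct k a0 a1 a2 a3 a4 a5 a6 a7 :
  k *: oct a0 a1 a2 a3 a4 a5 a6 a7 =
  oct (k * a0) (k * a1) (k * a2) (k * a3) (k * a4) (k * a5) (k * a6) (k * a7).
Proof. by []. Qed.

(** Signs such as [- (- a1)] stay unsimplified so that both sides agree by unfolding alone. *)
Lemma omul_oct a0 a1 a2 a3 a4 a5 a6 a7 b0 b1 b2 b3 b4 b5 b6 b7 :
  m (oct a0 a1 a2 a3 a4 a5 a6 a7) (oct b0 b1 b2 b3 b4 b5 b6 b7) =
  oct
    (a0 * b0 + al * (b1 * a1) + be * (b2 * a2 + al * ((- a3) * b3)) + ga * (b4 * a4 + al *
     ((- a5) * b5) + be * ((- a6) * b6 + al * ((- b7) * (- a7)))))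
    (a0 * b1 + b0 * a1 + be * (b2 * (- a3) + a2 * b3) + ga * (b4 * (- a5) + a4 * b5 + be *
     ((- a6) * (- b7) + b6 * (- a7))))
    (a0 * b2 + al * (b3 * (- a1)) + (b0 * a2 + al * (a3 * b1)) + ga * (b4 * (- a6) + al *
     ((- a7) * (- b5)) + (a4 * b6 + al * (b7 * (- a5)))))
    (a0 * b3 + b2 * (- a1) + (b0 * a3 + a2 * b1) + ga * (b4 * (- a7) + (- a6) * (- b5) +
     (a4 * b7 + b6 * (- a5))))
    (a0 * b4 + al * (b5 * (- a1)) + be * (b6 * (- a2) + al * ((- (- a3)) * b7)) + (b0 * a4
     + al * (a5 * b1) + be * (a6 * b2 + al * ((- b3) * a7))))
    (a0 * b5 + b4 * (- a1) + be * (b6 * (- (- a3)) + (- a2) * b7) + (b0 * a5 + a4 * b1 +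
     be * (a6 * (- b3) + b2 * a7)))
    (a0 * b6 + al * (b7 * (- (- a1))) + (b4 * (- a2) + al * ((- a3) * b5)) + (b0 * a6 + al
     * (a7 * (- b1)) + (a4 * b2 + al * (b3 * a5))))
    (a0 * b7 + b6 * (- (- a1)) + (b4 * (- a3) + (- a2) * b5) + (b0 * a7 + a6 * (- b1) +
     (a4 * b3 + b2 * a5))).
Proof. by []. Qed.

Definition octE := (omul_oct, oconj_oct, oone_oct, add_oct, opp_oct, scale_oct).

Ltac oct_ring :=
  repeat (let x := fresh "x" in intro x; elim/octP: x => ? ? ? ? ? ? ? ?);
  rewrite ?octE ?oform_oct; first [ring | congr oct; ring].

(** * Bilinearity, alternativity and conjugation *)

Lemma omulDl (x y z : O) : m (x + y) z = m x z + m y z.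
Proof. by move: x y z; oct_ring. Qed.

Lemma omulDr (x y z : O) : m x (y + z) = m x y + m x z.
Proof. by move: x y z; oct_ring. Qed.

Lemma omulZl k (x y : O) : m (k *: x) y = k *: m x y.
Proof. by move: x y; oct_ring. Qed.

Lemma omulZr k (x y : O) : m x (k *: y) = k *: m x y.
Proof. by move: x y; oct_ring. Qed.

Lemma omul0l (x : O) : m 0 x = 0.
Proof. by rewrite -(scale0r 0) omulZl !scale0r. Qed.

Lemma omulNl (x y : O) : m (- x) y = - m x y.
Proof. by rewrite -scaleN1r omulZl scaleN1r. Qed.

Lemma omulNr (x y : O) : m x (- y) = - m x y.
Proof. by rewrite -scaleN1r omulZr scaleN1r. Qed.

Lemma omul1l (x : O) : m e x = x.
Proof. by move: x; oct_ring. Qed.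

Lemma omul1r (x : O) : m x e = x.
Proof. by move: x; oct_ring. Qed.

(** Polarization of the left alternative law x(xz) = (xx)z. *)
Lemma omul_altl (x y z : O) : m x (m y z) + m y (m x z) = m (m x y + m y x) z.
Proof. by move: x y z; oct_ring. Qed.

Lemma omul_altr (x y z : O) : m (m x y) z + m (m x z) y = m x (m y z + m z y).
Proof. by move: x y z; oct_ring. Qed.

Lemma oconj_mul (x y : O) : cj (m x y) = m (cj y) (cj x).
Proof. by move: x y; oct_ring. Qed.

(** * The form and its adjoint rules *)

Lemma oformC (x y : O) : oform x y = oform y x.
Proof. by move: x y; oct_ring. Qed.

Lemma oformDl (x y z : O) : oform (x + y) z = oform x z + oform y z.
Proof. by move: x y z; oct_ring. Qed.

Lemma oformZl k (x y : O) : oform (k *: x) y = k * oform x y.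
Proof. by move: x y; oct_ring. Qed.

Lemma oformNl (x y : O) : oform (- x) y = - oform x y.
Proof. by rewrite -scaleN1r oformZl mulN1r. Qed.

Lemma oformNr (x y : O) : oform x (- y) = - oform x y.
Proof. by rewrite oformC oformNl oformC. Qed.

Lemma oform_mull (x y z : O) : oform (m x y) z = oform y (m (cj x) z).
Proof. by move: x y z; oct_ring. Qed.

Lemma oform_mulr (x y z : O) : oform (m x y) z = oform x (m z (cj y)).
Proof. by move: x y z; oct_ring. Qed.

Lemma omul_conj_form (x y : O) : m x (cj y) + m y (cj x) = (2 * oform x y) *: e.
Proof. by move: x y; oct_ring. Qed.

Lemma omul_anticomm (x y : O) : is_im x -> is_im y ->
  m x y + m y x = - (2 * oform x y) *: e.
Proof.
move=> hx hy; have := omul_conj_form x y.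
by rewrite hx hy !omulNr -opprD scaleNr => <-; rewrite opprK.
Qed.

Lemma omul_orthogonal (x y : O) : is_im x -> is_im y -> oform x y = 0 ->
  m x y + m y x = 0.
Proof. by move=> hx hy h; rewrite omul_anticomm // h mulr0 oppr0 scale0r. Qed.

Lemma is_im_orth1 (x : O) : oform e x = 0 -> is_im x.
Proof.
rewrite /is_im; elim/octP: x => a0 a1 a2 a3 a4 a5 a6 a7.
rewrite oone_oct oform_oct oconj_oct opp_oct => h.
have -> : a0 = 0 by rewrite -h; ring.
by rewrite oppr0.
Qed.

(* Pairing the associator equation with [v], after multiplying by [u], moves
   [u] and [v] past [x] and [y], and everything collapses to the scalar
   [(x y) u - u (x y)^* = - 2 <x y, u>]. *)
Lemma associator0_form (x y z u v : O) : (2 : F) != 0 ->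
    is_im x -> is_im y -> is_im z -> is_im u -> is_im v ->
    oform x u = 0 -> oform y u = 0 -> oform x v = 0 -> oform y v = 0 ->
    m (m x y) z = m x (m y z) ->
  oform (m x y) u * oform z v = oform z u * oform (m x y) v.
Proof.
move=> two_neq0 hx hy hz hu hv xu yu xv yv hxyz.
set w := m x y.
(* Orthogonal imaginary [p], [q] anticommute, so by polarized alternativity their left
   multiplications do too. *)
have swap p q r : is_im p -> is_im q -> oform p q = 0 ->
    m p (m q r) = - m q (m p r).
  move=> hp hq hpq; apply/eqP; rewrite -addr_eq0 omul_altl.
  by rewrite omul_orthogonal // omul0l.
have yxE : m y x = cj w by rewrite oconj_mul hx hy omulNl omulNr opprK.
have E : m y (m x u) = m u (cj w).
  have -> : m x u = - m u x.
    by apply/eqP; rewrite -addr_eq0 omul_orthogonal.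
  by rewrite omulNr swap // opprK yxE.
(* Right alternativity for [w], [z], [u]; then [z] moves across the form. *)
have lhs : oform (m (m w z) u) v =
    oform (m w u) (m v z) - 2 * oform z u * oform w v.
  have -> : m (m w z) u = - (2 * oform z u) *: w - m (m w u) z.
    have <- : m w (m z u + m u z) = - (2 * oform z u) *: w.
      by rewrite omul_anticomm // omulZr omul1r.
    by rewrite -omul_altr addrK.
  by rewrite oformDl oformZl oformNl (oform_mulr (m w u)) hz omulNr oformNr; ring.
(* For the other bracketing, [u], [x], [y] cross the form, [v] is swapped past [x] and [y], and [E]
   gathers the rest. *)
have rhs : oform (m (m x (m y z)) u) v = oform (m u (cj w)) (m v z).
  rewrite oform_mulr hu omulNr oform_mull hx omulNl omulNr opprK.
  rewrite oform_mull hy omulNl (swap x v) // omulNr opprK (swap y v) // E.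
  by rewrite [RHS]oformC oform_mull hv omulNl.
have wuE : m w u = - (2 * oform w u) *: e + m u (cj w).
  by rewrite scaleNr -omul_conj_form hu omulNr opprD opprK addrNK.
have e_vz : oform e (m v z) = - oform z v.
  by rewrite oformC oform_mulr hz omul1l oformNr oformC.
(* Equating both, the terms [oform (m u (cj w)) (m v z)] cancel and twice the claim remains. *)
apply: (mulfI two_neq0); apply/eqP; rewrite -subr_eq0; apply/eqP.
have := lhs; rewrite hxyz rhs wuE oformDl oformZl e_vz => h.
rewrite -[RHS](subrr (oform (m u (cj w)) (m v z))) {1}h; ring.
Qed.

(** * Nondegeneracy *)

(** The form is diagonal in the coordinate basis, with nonzero entries 1, -al, -be, al be, -ga, al
    ga, be ga, -al be ga; the coordinates of [u] are the values of [f] on this basis divided by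
    them. *)
Lemma oform_riesz (f : O -> F) : al != 0 -> be != 0 -> ga != 0 ->
    (forall k x y, f (k *: x + y) = k * f x + f y) ->
  exists u, forall x, f x = oform x u.
Proof.
move=> al0 be0 ga0 hf.
have f0 : f 0 = 0 by apply: (addIr (f 0)); rewrite -{1}[f 0]mul1r -hf scaler0 !add0r.
exists (oct (f (oct 1 0 0 0 0 0 0 0)) (- f (oct 0 1 0 0 0 0 0 0) / al)
  (- f (oct 0 0 1 0 0 0 0 0) / be) (f (oct 0 0 0 1 0 0 0 0) / (al * be))
  (- f (oct 0 0 0 0 1 0 0 0) / ga) (f (oct 0 0 0 0 0 1 0 0) / (al * ga))
  (f (oct 0 0 0 0 0 0 1 0) / (be * ga))
  (- f (oct 0 0 0 0 0 0 0 1) / (al * be * ga))).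
elim/octP => a0 a1 a2 a3 a4 a5 a6 a7; rewrite oform_oct.
(* The trailing [0] lets [hf] peel off every summand, the last included. *)
have -> : oct a0 a1 a2 a3 a4 a5 a6 a7 =
    a0 *: oct 1 0 0 0 0 0 0 0 + (a1 *: oct 0 1 0 0 0 0 0 0 +
    (a2 *: oct 0 0 1 0 0 0 0 0 + (a3 *: oct 0 0 0 1 0 0 0 0 +
    (a4 *: oct 0 0 0 0 1 0 0 0 + (a5 *: oct 0 0 0 0 0 1 0 0 +
    (a6 *: oct 0 0 0 0 0 0 1 0 + (a7 *: oct 0 0 0 0 0 0 0 1 + 0))))))).
  by rewrite addr0 !scale_oct !add_oct /=; congr oct; ring.
by rewrite !hf f0; field; rewrite al0 be0 ga0.
Qed.

(** Some coordinate of [t - projv U t] is nonzero; that coordinate, as a functional of [t], vanishes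
    on [U] and is represented by [oform_riesz]. *)
Lemma oform_separation (U : {vspace O}) (t : O) : al != 0 -> be != 0 -> ga != 0 ->
    t \notin U ->
  exists u, (forall x, x \in U -> oform x u = 0) /\ oform t u != 0.
Proof.
move=> al0 be0 ga0 tU; pose c i (x : O) : F := coord (vbasis fullv) i (x - projv U x).
have [i ci] : exists i, c i t != 0.
  case: (pickP (fun i => c i t != 0)) => [i ci | c0]; first by exists i.
  case/negP: tU; have <- : projv U t = t; last exact: memv_proj.
  apply/eqP; rewrite eq_sym -subr_eq0 (coord_vbasis (memvf (t - projv U t))).
  by rewrite big1 // => i _; move/negbFE/eqP: (c0 i); rewrite /c => ->; rewrite scale0r.
have [|u hu] := @oform_riesz (c i) al0 be0 ga0.
  by move=> k x y; rewrite /c linearP opprD addrACA -scalerBr linearP.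
exists u; split=> [x xU|]; last by rewrite -hu.
by rewrite -hu /c projv_id // subrr linear0.
Qed.

Lemma omul_mem_span (x y z : O) : (2 : F) != 0 -> al != 0 -> be != 0 -> ga != 0 ->
    is_im x -> is_im y -> is_im z -> m (m x y) z = m x (m y z) ->
    z \notin (<[e]> + (<[x]> + <[y]>))%VS ->
  m x y \in (<[e]> + (<[x]> + <[y]>) + <[z]>)%VS.
Proof.
move=> two_neq0 al0 be0 ga0 hx hy hz hxyz; set U := (<[e]> + _)%VS => zU.
have eU : e \in U by apply: subvP (addvSl _ _) _ (memv_line _).
have xU : x \in U by apply: subvP (addvSr _ _) _ _; apply: subvP (addvSl _ _) _ (memv_line _).
have yU : y \in U by apply: subvP (addvSr _ _) _ _; apply: subvP (addvSr _ _) _ (memv_line _).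
have [u [uU zu]] := oform_separation al0 be0 ga0 zU.
(* This [k] makes [m x y - k *: z] orthogonal to every [v] orthogonal to [U], so no such [v] can
   separate it from [U]. *)
pose k := oform (m x y) u / oform z u.
suff tU : m x y - k *: z \in U.
  by rewrite -(subrK (k *: z) (m x y)) memv_add // memvZ ?memv_line.
apply/negPn/negP => /(oform_separation al0 be0 ga0)[v [vU]].
rewrite oformDl oformNl oformZl => /negP[].
have := associator0_form two_neq0 hx hy hz (is_im_orth1 (uU _ eU))
  (is_im_orth1 (vU _ eU)) (uU _ xU) (uU _ yU) (vU _ xU) (vU _ yU) hxyz.
by rewrite /k mulrAC => ->; rewrite mulrAC divff // mul1r subrr.
Qed.

End Octonions.

(** * The subalgebra F1 + A *)

Lemma is_im_scale1 (F : fieldType) (k : F) : (2 : F) != 0 ->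
  is_im (k *: oone F) -> k = 0.
Proof.
move=> two_neq0; rewrite /is_im oone_oct scale_oct oconj_oct opp_oct.
case=> /eqP; rewrite mulr1 -subr_eq0 opprK -mulr2n -mulr_natl mulf_eq0.
by rewrite (negPf two_neq0) => /eqP.
Qed.

Theorem mainTheorem16 (F : fieldType) (al be ga : F)
  (hchar : 2%N \notin [pchar F])
  (hal : al != 0) (hbe : be != 0) (hga : ga != 0)
  (A : {vspace O8 F})
  (hdim : \dim A = 3%N)
  (him : forall x, x \in A -> is_im x)
  (hassoc : forall x y z, x \in A -> y \in A -> z \in A ->
     omul al be ga (omul al be ga x y) z = omul al be ga x (omul al be ga y z)) :
  let B := (<[oone F]> + A)%VS in
  (forall x y, x \in B -> y \in B -> omul al be ga x y \in B)
  /\ (forall x y z, x \in B -> y \in B -> z \in B ->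
     omul al be ga (omul al be ga x y) z = omul al be ga x (omul al be ga y z))
  /\ \dim B = 4%N.
Proof.
have two_neq0 : (2 : F) != 0 by move: hchar; rewrite inE /=.
have A_scale1 k : k *: oone F \in A -> k = 0 by move/him/(is_im_scale1 two_neq0).
move=> B.
have eB : oone F \in B by apply: subvP (addvSl _ _) _ (memv_line _).
have AB x : x \in A -> x \in B by apply: subvP; apply: addvSr.
have BP x : x \in B -> exists k a, a \in A /\ x = k *: oone F + a.
  by case/memv_addP=> _ /vlineP[k ->] [a aA ->]; exists k, a.
have A_mul x y : x \in A -> y \in A -> omul al be ga x y \in B.
  move=> xA yA.
  have xyA : (<[x]> + <[y]> <= A)%VS by rewrite subv_add -!memvE xA yA.
  (* The span of [x] and [y] has dimension at most 2, so it misses some [z] of [A]. *)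
  have /subvPn[z zA zxy] : ~~ (A <= <[x]> + <[y]>)%VS.
    apply/negP => /dimvS; rewrite hdim leqNgt; case/negP.
    apply: leq_ltn_trans (dimv_add_leqif _ _) _.
    by rewrite !dim_vline; apply: leq_add (leq_b1 _) (leq_b1 _).
  have /(omul_mem_span two_neq0 hal hbe hga (him _ xA) (him _ yA) (him _ zA)) :
      omul al be ga (omul al be ga x y) z = omul al be ga x (omul al be ga y z).
    exact: hassoc.
  (* If z = k1 + a with [a] in the span of [x] and [y], then k1 = z - a lies in [A], so k = 0. *)
  have zU : z \notin (<[oone F]> + (<[x]> + <[y]>))%VS.
    apply: contra zxy => /memv_addP[_ /vlineP[k ->] [a axy zE]].
    have k0 : k = 0.
      have := memvB zA (subvP xyA _ axy).
      by rewrite zE addrK => /A_scale1.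
    by rewrite zE k0 scale0r add0r.
  move/(_ zU); apply: subvP.
  by rewrite subv_add -memvE AB // andbT addvS.
split; [|split].
- move=> x y /BP[k [a [aA ->]]] /BP[l [b [bA ->]]].
  rewrite omulDl !omulDr !omulZl !omulZr !omul1l omul1r.
  by apply: memvD; apply: memvD; do ?apply: memvZ; rewrite ?A_mul //; apply: AB.
- move=> x y z /BP[k [a [aA ->]]] yB zB.
  (* The associator is trilinear and vanishes when an entry is 1, so scalar parts drop out one
     variable at a time. *)
  rewrite !omulDl !omulZl !omul1l; congr (_ + _).
  case/BP: yB => l [b [bA ->]].
  rewrite !(omulDl, omulDr, omulZl, omulZr, omul1l, omul1r); congr (_ + _).
  case/BP: zB => n [c [cA ->]].
  by rewrite !omulDr !omulZr !omul1r hassoc.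
- have e0 : oone F != 0.
    apply/eqP => e0; have := A_scale1 1; rewrite e0 scaler0 mem0v => /(_ isT).
    by apply/eqP; rewrite oner_eq0.
  (* The sum is direct: a scalar lying in [A] is zero. *)
  rewrite dimv_disjoint_sum ?hdim ?dim_vline ?e0 //.
  apply/eqP; rewrite -subv0; apply/subvP => x; rewrite memv_cap memv0.
  by case/andP=> /vlineP[k ->] /A_scale1 ->; rewrite scale0r.
Qed.
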